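(* Let $\mathbb{P}$ be a partition of $\Omega$, and let $\mu(\cdot|\cdot)$ be a dF-coherent probability, or alternatively a W-coherent lower probability, a W-coherent upper probability, a C-convex lower probability, or a C-convex upper probability, on $\mathcal{A}_C(\mathbb{P})$. Let $C|D$ be an arbitrary conditional event with $C|D\neq\varnothing|D$ and $C|D\neq D|D$. Then an extension of $\mu$ to $\mathcal{A}_C(\mathbb{P})\cup\{C|D\}$ is, respectively, a dF-coherent probability, a W-coherent lower (upper) probability, or a C-convex lower (upper) probability, if and only if $$\mu(C|D)\in[\mu((C|D)_* ),\ \mu((C|D)^* )].$$
   Context: Events are subsets of a nonempty set $\Omega$ (the sure event); $\wedge,\vee,\neg$ denote intersection, union, complement; $\Rightarrow$ denotes inclusion; an event is identified with its indicator function. A gamble is a bounded function $X:\Omega\to\mathbb{R}$. For an event $B\neq\varnothing$, the conditional gamble $X|B$ is the restriction of $X$ to $B$ (so two conditional gambles with the same $B$ and the same restriction are identified); $\sup(X|B)=\sup_{\omega\in B}X(\omega)$. A conditional event $A|B$ ($B\ne\varnothing$) is the conditional gamble $I_A|B$; in particular $A|B=A\wedge B|B$. Consistency notions, for a set $\mathcal{S}$ of conditional gambles. A map $\underline P:\mathcal{S}\to\mathbb{R}$ (lower prevision) is W-coherent iff for all $n\in\mathbb{N}$, all $X_0|B_0,\dots,X_n|B_n\in\mathcal{S}$ and all real $s_0,\dots,s_n\ge 0$, setting $B=\bigvee_{i=0}^n B_i$ and $\underline G=\sum_{i=1}^n s_iB_i(X_i-\underline P(X_i|B_i))-s_0B_0(X_0-\underline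 P(X_0|B_0))$, one has $\sup(\underline G|B)\ge 0$. It is convex iff the same condition is required only for stakes with $\sum_{i=1}^n s_i=s_0>0$; it is C-convex (centered convex) iff it is convex and $X|B\in\mathcal{S}$ implies $0|B\in\mathcal{S}$ and $\underline P(0|B)=0$. A map $\overline P:\mathcal{S}\to\mathbb{R}$ (upper prevision) is W-coherent, respectively C-convex, iff the lower prevision $-X|B\mapsto-\overline P(X|B)$ on $\{-X|B: X|B\in\mathcal{S}\}$ is. A map $P:\mathcal{S}\to\mathbb{R}$ is dF-coherent iff for all $n\in\mathbb{N}$, all $X_1|B_1,\dots,X_n|B_n\in\mathcal{S}$ and all $s_1,\dots,s_n\in\mathbb{R}$, with $G=\sum_{i=1}^n s_iB_i(X_i-P(X_i|B_i))$ and $B=\bigvee_{i=1}^n B_i$, one has $\sup(G|B)\ge 0$. These are called (lower, upper, precise) probabilities when all elements of $\mathcal{S}$ are conditional events. Convention for C-convexity of extensions: when $\mu$ is extended to $C|D$, the event $\varnothing|D$ (i.e. $0|D$), if not already present, is understood to be adjoined to the domain with value $0$. A partition $\mathbb{P}$ is a set of pairwise disjoint nonempty events with union $\Omega$; $\mathcal{A}(\mathbb{P})$ is the set of all unions of elements of $\mathbb{P}$; $\mathcal{A}_C(\mathbb{P})=\{A|B: A,B\in\mathcal{A}(\mathbb{P}),\,B\ne\varnothing\}$. For an event $E$: $E_*=\bigvee_{e\in\mathbb{P}:\,e\Rightarrow E}e$ and $E^*=\bigvee_{e\in\mathbb{P}:\,e\wedge E\ne\varnothing}e$. For a conditional event $C|D$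 with $C|D\neq\varnothing|D$, $C|D\ne D|D$: $(C|D)_*=(C\wedge D)_*\,|\,[(C\wedge D)_*\vee(\neg C\wedge D)^*]$ and $(C|D)^*=(C\wedge D)^*\,|\,[(C\wedge D)^*\vee(\neg C\wedge D)_*]$; both belong to $\mathcal{A}_C(\mathbb{P})$. *)

(* Defs.v *)
From mathcomp Require Import all_boot all_order all_algebra.
From mathcomp Require Import all_classical all_reals all_analysis.
Import Order.TTheory GRing.Theory Num.Theory numFieldNormedType.Exports.

Set Implicit Arguments.
Unset Strict Implicit.
Unset Printing Implicit Defensive.

Local Open Scope classical_set_scope.
Local Open Scope ring_scope.

(** Conditional gambles. The restriction of X to B is encoded by the canonical
    representative [cg_fun] that agrees with X on B and vanishes outside B, so
    that Leibniz equality (lemma [cgambleP]) is equality of the conditioning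
    events together with equality of the restrictions. *)
Record cgamble (R : realType) (Omega : Type) := CGamble {
  cg_cond : set Omega ;
  cg_fun :> Omega -> R ;
  cg_cond_neq0 : cg_cond !=set0 ;
  cg_bounded : bounded_fun (cg_fun : Omega -> R^o) ;
  cg_out : forall w, ~ cg_cond w -> cg_fun w = 0 }.

Section ConditionalGambles.
Variables (R : realType) (Omega : Type).
Implicit Types (A B : set Omega) (x y : cgamble R Omega) (X : Omega -> R).

Lemma cgambleP x y :
  cg_cond x = cg_cond y -> {in cg_cond x, x =1 y} -> x = y.
Proof.
case: x => B X B0 bX oX; case: y => B' Y B'0 bY oY /= eB eX; subst B'.
have {}eX : X = Y.
  apply/funext => w; case: (pselect (B w)) => Bw; first exact/eX/mem_set.
  by rewrite oX// oY.
subst Y; congr CGamble; exact: Prop_irrelevance.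
Qed.

Lemma restr_bounded B X :
  bounded_fun (X : Omega -> R^o) ->
  bounded_fun (patch (cst 0) B X : Omega -> R^o).
Proof.
move=> [M [Mreal XM]]; exists M; split => // N MN w _ /=.
rewrite /patch; case: ifP => _; first exact: XM.
by rewrite /cst normr0; apply: le_trans (normr_ge0 (X w)) _; exact: XM.
Qed.

Lemma restr_out B X w : ~ B w -> patch (cst 0) B X w = 0.
Proof. by move=> Bw; rewrite /patch memNset. Qed.

Definition condg X (bX : bounded_fun (X : Omega -> R^o)) B (B0 : B !=set0) :
    cgamble R Omega :=
  CGamble B0 (restr_bounded B bX) (@restr_out B X).

Lemma indic_bounded A : bounded_fun (\1_A : Omega -> R^o).
Proof.
exists 1; split => [|N N1 w _ /=]; first exact: real1.
rewrite indicE normr_nat; apply: le_trans (ltW N1).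
by case: (_ \in _).
Qed.

Definition cevent A B (B0 : B !=set0) : cgamble R Omega :=
  condg (indic_bounded A) B0.

Definition czero B (B0 : B !=set0) : cgamble R Omega :=
  condg (bounded_cst (0 : R^o) setT) B0.

Lemma cevent_set0 B (B0 : B !=set0) : cevent set0 B0 = czero B0.
Proof. by apply: cgambleP => //= w _; rewrite /patch indicE in_set0. Qed.

Lemma copp_bounded x : bounded_fun ((fun w => - x w) : Omega -> R^o).
Proof. exact: (bounded_funN (@cg_bounded _ _ x)). Qed.

Lemma copp_out x w : ~ cg_cond x w -> - x w = 0.
Proof. by move=> xw; rewrite cg_out// oppr0. Qed.

Definition copp x : cgamble R Omega :=
  CGamble (cg_cond_neq0 x) (copp_bounded x) (@copp_out x).

End ConditionalGambles.

Arguments cevent R {Omega} A {B} B0.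
Arguments czero R {Omega B} B0.

(** A prevision on a set S of conditional gambles is a total function
    [cgamble R Omega -> R] of which only the values on S are relevant: every
    notion below evaluates it on S only. *)
Section Consistency.
Variables (R : realType) (Omega : Type).
Implicit Types (S : set (cgamble R Omega)) (P : cgamble R Omega -> R).

Definition gain P (s : R) (x : cgamble R Omega) (w : Omega) : R :=
  s * (\1_(cg_cond x) w * (x w - P x)).

Definition lower_gain P n (s0 : R) (x0 : cgamble R Omega)
    (s : 'I_n -> R) (x : 'I_n -> cgamble R Omega) (w : Omega) : R :=
  \sum_(i < n) gain P (s i) (x i) w - gain P s0 x0 w.

Definition lower_cond n (x0 : cgamble R Omega) (x : 'I_n -> cgamble R Omega) :
    set Omega :=
  cg_cond x0 `|` \bigcup_(i in [set: 'I_n]) cg_cond (x i).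

Definition W_coherent_lower S P : Prop :=
  forall (n : nat) (x0 : cgamble R Omega) (x : 'I_n -> cgamble R Omega)
         (s0 : R) (s : 'I_n -> R),
    S x0 -> (forall i, S (x i)) -> 0 <= s0 -> (forall i, 0 <= s i) ->
    0 <= sup (lower_gain P s0 x0 s x @` lower_cond x0 x).

Definition convex_lower S P : Prop :=
  forall (n : nat) (x0 : cgamble R Omega) (x : 'I_n -> cgamble R Omega)
         (s0 : R) (s : 'I_n -> R),
    S x0 -> (forall i, S (x i)) -> 0 <= s0 -> (forall i, 0 <= s i) ->
    \sum_(i < n) s i = s0 -> 0 < s0 ->
    0 <= sup (lower_gain P s0 x0 s x @` lower_cond x0 x).

Definition C_convex_lower S P : Prop :=
  convex_lower S P /\
  forall x, S x ->
    S (czero R (cg_cond_neq0 x)) /\ P (czero R (cg_cond_neq0 x)) = 0.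

(** The lower prevision -X|B |-> - P(X|B), whose domain is [copp @` S]. *)
Definition conjugate P : cgamble R Omega -> R := fun y => - P (copp y).

Definition W_coherent_upper S P : Prop :=
  W_coherent_lower (@copp R Omega @` S) (conjugate P).

Definition C_convex_upper S P : Prop :=
  C_convex_lower (@copp R Omega @` S) (conjugate P).

(** At least one conditional gamble is required, as the supremum is taken over
    the union of the conditioning events. *)
Definition dF_coherent S P : Prop :=
  forall (n : nat) (x : 'I_n.+1 -> cgamble R Omega) (s : 'I_n.+1 -> R),
    (forall i, S (x i)) ->
    0 <= sup ((fun w => \sum_(i < n.+1) gain P (s i) (x i) w) @`
              \bigcup_(i in [set: 'I_n.+1]) cg_cond (x i)).

(** P, given on S, with z adjoined to the domain with value 0 unless z is
    already in S: domain [S `|` [set z]], map [adjoin0 S P]. *)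
Definition adjoin0 S P : cgamble R Omega -> R := patch (cst 0) S P.

End Consistency.

Section Approximations.
Variables (R : realType) (Omega : Type) (PP : set (set Omega)).
Implicit Types (A B C D E : set Omega).

Definition unions_of : set (set Omega) :=
  [set A | exists2 F : set (set Omega),
     F `<=` PP & A = \bigcup_(e in F) e].

Definition cevents_of : set (cgamble R Omega) :=
  [set x | exists A B (B0 : B !=set0),
     [/\ unions_of A, unions_of B & x = cevent R A B0]].

Definition inner E : set Omega :=
  \bigcup_(e in [set e | PP e /\ e `<=` E]) e.

Definition outer E : set Omega :=
  \bigcup_(e in [set e | PP e /\ e `&` E !=set0]) e.

Lemma outer_neq0 E : partition PP id setT -> E !=set0 -> outer E !=set0.
Proof.
move=> [covP _ _] [w Ew]; exists w.
have : cover PP id w by rewrite covP.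
by move=> [e Pe ew]; exists e => //; split => //; exists w.
Qed.

Lemma cevent_neqT C D (D0 : D !=set0) :
  cevent R C D0 <> cevent R D D0 -> (~` C `&` D) !=set0.
Proof.
move=> neq; apply: contrapT => empty; apply: neq; apply: cgambleP => //= w.
rewrite inE => Dw; rewrite /patch mem_set// !indicE (mem_set Dw).
by rewrite mem_set//; apply: contrapT => Cw; apply: empty; exists w.
Qed.

Lemma cevent_neq0 C D (D0 : D !=set0) :
  cevent R C D0 <> cevent R set0 D0 -> (C `&` D) !=set0.
Proof.
move=> neq; apply: contrapT => empty; apply: neq; apply: cgambleP => //= w.
rewrite inE => Dw; rewrite /patch mem_set// !indicE in_set0.
by rewrite memNset// => Cw; apply: empty; exists w.
Qed.

Lemma inner_cond_neq0 C D (D0 : D !=set0) : partition PP id setT ->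
  cevent R C D0 <> cevent R D D0 ->
  (inner (C `&` D) `|` outer (~` C `&` D)) !=set0.
Proof.
move=> partP /cevent_neqT /(outer_neq0 partP)[w ?].
by exists w; right.
Qed.

Lemma outer_cond_neq0 C D (D0 : D !=set0) : partition PP id setT ->
  cevent R C D0 <> cevent R set0 D0 ->
  (outer (C `&` D) `|` inner (~` C `&` D)) !=set0.
Proof.
move=> partP /cevent_neq0 /(outer_neq0 partP)[w ?].
by exists w; left.
Qed.

(** (C|D)_* and (C|D)^*; the hypotheses partP, neqT and neq0 only serve to
    prove the conditioning events nonempty. *)
Definition inner_cevent C D (D0 : D !=set0) (partP : partition PP id setT)
    (neqT : cevent R C D0 <> cevent R D D0) : cgamble R Omega :=
  cevent R (inner (C `&` D)) (inner_cond_neq0 partP neqT).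

Definition outer_cevent C D (D0 : D !=set0) (partP : partition PP id setT)
    (neq0 : cevent R C D0 <> cevent R set0 D0) : cgamble R Omega :=
  cevent R (outer (C `&` D)) (outer_cond_neq0 partP neq0).

End Approximations.

Arguments cevents_of R {Omega} PP.

(* Main.v *)
Require Import Defs.
From mathcomp Require Import all_boot all_order all_algebra.
From mathcomp Require Import all_classical all_reals all_analysis.
From mathcomp Require Import lra.
Import Order.TTheory GRing.Theory Num.Theory numFieldNormedType.Exports.

Set Implicit Arguments.
Unset Strict Implicit.
Unset Printing Implicit Defensive.

Local Open Scope classical_set_scope.
Local Open Scope ring_scope.

(** Every notion of consistency at hand asks, for a class of finite families of
    signed stakes, that no total gain be uniformly negative; so the proof can
    treat one family of stakes at a time. If mu(C|D) lies in the interval, a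
    family of bets involving C|D is compared with the one where every bet on
    C|D is moved, with the same stake, to the conditional event (C|D)^* when the
    total stake on C|D is nonnegative, and to (C|D)_* when it is negative: inside
    each atom of the partition there is a point where the original gain is at
    least the new one, which is constant on the atom. Conversely, (C|D)_* lies
    below C|D, and C|D below (C|D)^*, in the Goodman-Nguyen order, for which
    consistent probabilities are monotone. *)

(** [sup] is 0 by default on a set without supremum; the two hypotheses exclude this. The margin
    [eps] is there because the supremum need not be attained. *)
Lemma sup_ge0P (R : realType) (T : Type) (A : set T) (f : T -> R) :
    A !=set0 -> (exists M, forall w, f w <= M) ->
  0 <= sup (f @` A) <-> forall eps, 0 < eps -> exists2 w, A w & - eps < f w.
Proof.
move=> [w0 Aw0] [M fM].
have hs : has_sup (f @` A).
  by split; [exists (f w0), w0 | exists M => _ [w _ <-]; exact: fM].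
split=> [sup0 eps eps0|fA].
  have [_ [w Aw <-] fw] := sup_adherent eps0 hs.
  by exists w => //; lra.
rewrite leNgt; apply/negP => sup0.
(* With this margin the point obtained has a value above the supremum. *)
have eps0 : 0 < - sup (f @` A) by lra.
have [w Aw] := fA _ eps0; rewrite opprK ltNge => /negP; apply.
by apply: ub_le_sup; [case: hs | exists w].
Qed.

(** * Consistency as a condition on families of signed stakes *)

Section Stakes.
Variables (R : realType) (Omega : Type).
Implicit Types (S : set (cgamble R Omega)) (P : cgamble R Omega -> R).
Implicit Types (x y : cgamble R Omega).

Lemma gainZ P s x w : gain P s x w = s * gain P 1 x w.
Proof. by rewrite /gain mul1r. Qed.

Lemma gain_cevent P s A B (B0 : B !=set0) w :
  gain P s (cevent R A B0) w = s * (\1_B w * (\1_A w - P (cevent R A B0))).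
Proof.
rewrite /gain /= !indicE /patch; case: ifP => _.
  by rewrite indicE.
by rewrite !mul0r.
Qed.

Lemma gain_le P s x : exists M, forall w, gain P s x w <= M.
Proof.
have [M [_ xM]] := cg_bounded x.
(* Boundedness gives a bound by each real strictly above [M], whence the [+ 1]; the absolute value
   keeps the bound nonnegative where the bet is called off. *)
exists (`|s| * (`|M| + 1 + `|P x|)) => w.
apply: le_trans (ler_norm _) _; rewrite /gain normrM ler_wpM2l//.
rewrite indicE; case: (_ \in _); rewrite /= ?(mul1r, mul0r, normr0).
  apply: le_trans (ler_normB _ _) _; rewrite lerD2r.
  apply: (xM (`|M| + 1)) => //; apply: le_lt_trans (ler_norm _) _.
  by rewrite ltrDl.
by rewrite !addr_ge0.
Qed.

Lemma sum_gain_le n P (s : 'I_n -> R) (x : 'I_n -> cgamble R Omega) :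
  exists M, forall w, \sum_(i < n) gain P (s i) (x i) w <= M.
Proof.
have [M MP] := choice (fun i => gain_le P (s i) (x i)).
by exists (\sum_i M i) => w; apply: ler_sum => i _.
Qed.

(** The stakes are fixed and the gambles vary, so that each notion becomes a class of admissible
    stakes. For [n = 0] the condition is false, as no conditioning event is available; it is applied
    to nonempty families. *)
Definition avoids_loss S P n (s : 'I_n -> R) : Prop :=
  forall x : 'I_n -> cgamble R Omega, (forall i, S (x i)) ->
  forall eps, 0 < eps -> exists2 w, exists i, cg_cond (x i) w &
    - eps < \sum_(i < n) gain P (s i) (x i) w.

(* The stakes of a lower prevision as a single family, the stake [s0] against
   [x0] being counted negatively at index [ord0]. *)
Definition stakes n (s0 : R) (s : 'I_n -> R) (i : 'I_n.+1) : R :=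
  oapp s (- s0) (unlift ord0 i).

Lemma lower_supP S P n s0 (s : 'I_n -> R) :
  (forall x0 (x : 'I_n -> cgamble R Omega), S x0 -> (forall i, S (x i)) ->
     0 <= sup (lower_gain P s0 x0 s x @` lower_cond x0 x)) <->
  avoids_loss S P (stakes s0 s).
Proof.
have gE (x : 'I_n.+1 -> cgamble R Omega) w :
    \sum_(i < n.+1) gain P (stakes s0 s i) (x i) w =
    lower_gain P s0 (x ord0) s (fun i => x (lift ord0 i)) w.
  rewrite big_ord_recl /stakes unlift_none /= /lower_gain addrC; congr +%R.
    by apply: eq_bigr => i _; rewrite liftK.
  by rewrite /gain mulNr.
have cE (x : 'I_n.+1 -> cgamble R Omega) w :
    lower_cond (x ord0) (fun i => x (lift ord0 i)) w <->
    exists i, cg_cond (x i) w.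
  split=> [[xw|[i _ xw]]|[i]]; [by exists ord0 | by exists (lift ord0 i) |].
  by have [j ->|->] := unliftP ord0 i => xw; [right; exists j | left].
have sE (x : 'I_n.+1 -> cgamble R Omega) :
    0 <= sup (lower_gain P s0 (x ord0) s (fun i => x (lift ord0 i)) @`
              lower_cond (x ord0) (fun i => x (lift ord0 i))) <->
    forall eps, 0 < eps -> exists2 w, exists i, cg_cond (x i) w &
      - eps < \sum_(i < n.+1) gain P (stakes s0 s i) (x i) w.
  rewrite sup_ge0P.
  - split=> H eps /H[w xw gw]; exists w; rewrite ?gE//; first exact/cE.
      exact/cE.
    by rewrite -gE.
  - by have [w xw] := cg_cond_neq0 (x ord0); exists w; left.
  - have [M MP] := sum_gain_le P (stakes s0 s) x.
    by exists M => w; rewrite -gE.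
split=> [H x Sx|H x0 x Sx0 Sx]; first by apply/sE/H.
(* [x'] puts [x0] in front of the family [x]. *)
pose x' i := oapp x x0 (unlift ord0 i).
have -> : x0 = x' ord0 by rewrite /x' unlift_none.
have -> : x = fun i => x' (lift ord0 i).
  by apply/funext => i; rewrite /x' liftK.
by apply/sE/H => i; rewrite /x'; case: unlift.
Qed.

Lemma W_coherent_lowerP S P : W_coherent_lower S P <->
  forall n s0 (s : 'I_n -> R), 0 <= s0 -> (forall i, 0 <= s i) ->
  avoids_loss S P (stakes s0 s).
Proof.
split=> [H n s0 s s0_ge0 s_ge0|H n x0 x s0 s Sx0 Sx s0_ge0 s_ge0].
  by apply/lower_supP => x0 x Sx0 Sx; exact: H.
by move: x0 x Sx0 Sx; apply/lower_supP/H.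
Qed.

Lemma convex_lowerP S P : convex_lower S P <->
  forall n s0 (s : 'I_n -> R), (forall i, 0 <= s i) -> \sum_(i < n) s i = s0 ->
  0 < s0 -> avoids_loss S P (stakes s0 s).
Proof.
split=> [H n s0 s s_ge0 ss0 s0_gt0|H n x0 x s0 s Sx0 Sx s0_ge0 s_ge0 ss0 s0_gt0].
  by apply/lower_supP => x0 x Sx0 Sx; apply: H => //; exact: ltW.
by move: x0 x Sx0 Sx; apply/lower_supP/H.
Qed.

Lemma dF_coherentP S P : dF_coherent S P <->
  forall n (s : 'I_n.+1 -> R), avoids_loss S P s.
Proof.
have sE n (x : 'I_n.+1 -> cgamble R Omega) (s : 'I_n.+1 -> R) :
    0 <= sup ((fun w => \sum_(i < n.+1) gain P (s i) (x i) w) @`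
              \bigcup_(i in [set: 'I_n.+1]) cg_cond (x i)) <->
    forall eps, 0 < eps -> exists2 w, exists i, cg_cond (x i) w &
      - eps < \sum_(i < n.+1) gain P (s i) (x i) w.
  rewrite sup_ge0P; last exact: sum_gain_le.
    by split=> H eps /H[w [i]]; exists w => //; exists i.
  by have [w xw] := cg_cond_neq0 (x ord0); exists w, ord0.
by split=> [H n s x Sx|H n x s Sx]; apply/sE/H.
Qed.

Lemma coppK : involutive (@Defs.copp R Omega).
Proof. by move=> x; apply: cgambleP => //= w _; rewrite opprK. Qed.

Lemma copp_czero (B : set Omega) (B0 : B !=set0) :
  Defs.copp (Defs.czero R B0) = Defs.czero R B0.
Proof.
by apply: cgambleP => //= w _; rewrite /patch; case: ifP; rewrite oppr0.
Qed.

(** A bet on [-X] at the conjugate price is the bet on [X] with the opposite stake. Upper notions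
    thus become lower ones with all stakes negated. *)
Lemma avoids_loss_conjugate S P n (s : 'I_n -> R) :
  avoids_loss (@Defs.copp R Omega @` S) (conjugate P) s <->
  avoids_loss S P (fun i => - s i).
Proof.
have gE r x w : gain (conjugate P) r (Defs.copp x) w = gain P (- r) x w.
  rewrite /gain /conjugate coppK /= opprK mulNr -mulrN -mulrN.
  by congr (_ * (_ * _)); rewrite opprB addrC.
split=> H x Sx eps eps0.
  have [w xw] := H (fun i => Defs.copp (x i)) (fun i => ex_intro2 _ _ _ (Sx i) erefl)
    _ eps0.
  by under eq_bigr do rewrite gE; exists w.
have {}Sx i : S (Defs.copp (x i)) by have [y Sy <-] := Sx i; rewrite coppK.
have [w xw] := H _ Sx _ eps0.
by under eq_bigr do rewrite -gE coppK; exists w.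
Qed.

Lemma W_coherent_upperP S P : W_coherent_upper S P <->
  forall n s0 (s : 'I_n -> R), 0 <= s0 -> (forall i, 0 <= s i) ->
  avoids_loss S P (fun i => - stakes s0 s i).
Proof.
rewrite /W_coherent_upper W_coherent_lowerP.
by split=> H n s0 s ? ?; apply/avoids_loss_conjugate/H.
Qed.

Definition centered S P : Prop :=
  forall x, S x ->
    S (Defs.czero R (cg_cond_neq0 x)) /\ P (Defs.czero R (cg_cond_neq0 x)) = 0.

Lemma C_convex_upperP S P : C_convex_upper S P <->
  (forall n s0 (s : 'I_n -> R), (forall i, 0 <= s i) ->
   \sum_(i < n) s i = s0 -> 0 < s0 ->
   avoids_loss S P (fun i => - stakes s0 s i)) /\ centered S P.
Proof.
have coppE x : (@Defs.copp R Omega @` S) x <-> S (Defs.copp x).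
  by split=> [[y Sy <-]|Sx]; rewrite ?coppK//; exists (Defs.copp x); rewrite ?coppK.
rewrite /C_convex_upper /C_convex_lower convex_lowerP; split=> -[H cen]; split.
- by move=> n s0 s ? ? ?; apply/avoids_loss_conjugate/H.
- move=> x Sx; have /cen[] : (@Defs.copp R Omega @` S) (Defs.copp x) by exists x.
  rewrite coppE /conjugate copp_czero => ? /eqP.
  by rewrite oppr_eq0 => /eqP.
- by move=> n s0 s ? ? ?; apply/avoids_loss_conjugate/H.
- move=> x /coppE /cen[].
  by rewrite coppE /conjugate copp_czero => ? ->; rewrite oppr0.
Qed.

Lemma avoids_loss_pair S P s0 s1 x y eps :
  avoids_loss S P (stakes s0 (fun _ : 'I_1 => s1)) ->
  S x -> S y -> 0 < eps ->
  exists2 w, cg_cond x w \/ cg_cond y w &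
    - eps < s1 * gain P 1 y w - s0 * gain P 1 x w.
Proof.
move=> /lower_supP H Sx Sy eps0.
have {H} := H x (fun=> y) Sx (fun=> Sy).
rewrite sup_ge0P.
- move=> /(_ _ eps0)[w cw gw]; exists w.
    by case: cw => [|[]]; [left|right].
  move: gw; rewrite /lower_gain big_ord1.
  by rewrite [gain _ s1 _ _]gainZ [gain _ s0 _ _]gainZ.
- by have [w xw] := cg_cond_neq0 x; exists w; left.
- have [M MP] := gain_le P s1 y.
  have [N NP] := gain_le P (- s0) x.
  exists (M + N) => w; rewrite /lower_gain big_ord1 lerD//.
  by have := NP w; rewrite /gain mulNr.
Qed.

End Stakes.

(** * Bounds and monotonicity of consistent probabilities *)

Section Necessity.
Variables (R : realType) (Omega : Type).
Implicit Types (S : set (cgamble R Omega)) (P : cgamble R Omega -> R).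
Implicit Types (x y : cgamble R Omega) (A B C D : set Omega).

(* What lower and upper consistency share: one unit bet against another. *)
Definition avoids_swap_loss S P : Prop :=
  forall x y, S x -> S y -> forall eps, 0 < eps ->
  exists2 w, cg_cond x w \/ cg_cond y w & - eps < gain P 1 y w - gain P 1 x w.

Definition unit_valued S P : Prop :=
  forall A B (B0 : B !=set0), S (cevent R A B0) ->
  0 <= P (cevent R A B0) <= 1.

Definition zero_normed S P : Prop :=
  forall B (B0 : B !=set0), S (cevent R set0 B0) -> P (cevent R set0 B0) = 0.

Lemma zero_normed_centered S P : centered S P -> zero_normed S P.
Proof. by move=> cen B B0 /cen[_]; rewrite -cevent_set0. Qed.

(** Exchange [A|B] with [0|B], whose gain is zero: only a bet for or against [A|B] remains, and it
    loses surely once the price leaves [0, 1]. *)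
Lemma unit_valued_centered S P :
  centered S P -> avoids_swap_loss S P -> unit_valued S P.
Proof.
move=> cen swap A B B0 SA; have [] := cen _ SA; rewrite -cevent_set0 /=.
move=> S0 P0; apply/andP; split; rewrite leNgt; apply/negP => PA.
- have eps0 : 0 < - P (cevent R A B0) by rewrite oppr_gt0.
  have [w wB] := swap _ _ SA S0 _ eps0; have {}wB : B w by case: wB.
  rewrite !gain_cevent P0 !indicE (mem_set wB) in_set0.
  by case: (w \in A) => /=; lra.
- have eps0 : 0 < P (cevent R A B0) - 1 by rewrite subr_gt0.
  have [w wB] := swap _ _ S0 SA _ eps0; have {}wB : B w by case: wB.
  rewrite !gain_cevent P0 !indicE (mem_set wB) in_set0.
  by case: (w \in A) => /=; lra.
Qed.

(** Replaces centering for W- and dF-coherence, whose domain may lack [0|D]. Convexity gives no such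
    isolated bets, since its signed stakes sum to zero. *)
Definition avoids_single_loss S P : Prop :=
  forall x, S x -> forall eps, 0 < eps ->
  (exists2 w, cg_cond x w & - eps < gain P 1 x w) /\
  (exists2 w, cg_cond x w & - eps < - gain P 1 x w).

Lemma unit_valued_single S P : avoids_single_loss S P -> unit_valued S P.
Proof.
move=> single A B B0 SA; apply/andP; split; rewrite leNgt; apply/negP => PA.
- have eps0 : 0 < - P (cevent R A B0) by rewrite oppr_gt0.
  have [_ [w wB]] := single _ SA _ eps0.
  rewrite !gain_cevent !indicE (mem_set (wB : B w)).
  by case: (w \in A) => /=; lra.
- have eps0 : 0 < P (cevent R A B0) - 1 by rewrite subr_gt0.
  have [[w wB +] _] := single _ SA _ eps0.
  rewrite !gain_cevent !indicE (mem_set (wB : B w)).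
  by case: (w \in A) => /=; lra.
Qed.

Lemma zero_normed_single S P : avoids_single_loss S P -> zero_normed S P.
Proof.
move=> single B B0 S0; apply/eqP; rewrite eq_le; apply/andP; split.
- rewrite leNgt; apply/negP => P0; have [[w wB +] _] := single _ S0 _ P0.
  by rewrite gain_cevent !indicE (mem_set (wB : B w)) in_set0 /=; lra.
- by have /andP[] := unit_valued_single single S0.
Qed.

(* The hypotheses on [A], [B], [C], [D] say that [A|B] lies below [C|D] in the
   Goodman-Nguyen order. *)
Lemma goodman_nguyen_le S P A B C D (B0 : B !=set0) (D0 : D !=set0) :
  avoids_swap_loss S P -> unit_valued S P ->
  S (cevent R A B0) -> S (cevent R C D0) ->
  A `&` B `<=` C `&` D -> ~` C `&` D `<=` ~` A `&` B ->
  P (cevent R A B0) <= P (cevent R C D0).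
Proof.
move=> swap unit SA SC AC CA; rewrite leNgt; apply/negP => lt_ca.
have /andP[_ a1] := unit _ _ _ SA; have /andP[c0 _] := unit _ _ _ SC.
have eps0 : 0 < P (cevent R A B0) - P (cevent R C D0) by rewrite subr_gt0.
have [w wDB] := swap _ _ SC SA _ eps0; rewrite !gain_cevent !indicE.
(* Write a and c for the two prices. If both bets are on, the gain is at most c - a. Outside [D] the
   bet on [A|B] is lost, with gain -a, and c >= 0 suffices; outside [B] the event [C] occurs, with
   gain c - 1, and a <= 1 suffices. The other cases contradict the order or [wDB]. *)
case: (boolP (w \in A)) => wA; case: (boolP (w \in B)) => wB;
  case: (boolP (w \in C)) => wC; case: (boolP (w \in D)) => wD /=;
  rewrite ?inE in wA wB wC wD; rewrite ?notin_setE in wA wB wC wD; try lra.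
all: exfalso; try by have [] := AC w (conj wA wB).
all: try by have [] := CA w (conj wC wD).
all: by case: wDB.
Qed.

End Necessity.

(** * Atoms, inner and outer approximations *)

Section Extension.
Variables (R : realType) (Omega : Type) (PP : set (set Omega)).
Hypothesis partP : partition PP id setT.
Implicit Types (A B C D E e : set Omega).

Local Notation AC := (cevents_of R PP).

Lemma partition_atom w : exists2 e, PP e & e w.
Proof.
have [cov _ _] := partP; have : cover PP id w by rewrite cov.
by move=> [e]; exists e.
Qed.

Lemma partition_eq e1 e2 w : PP e1 -> PP e2 -> e1 w -> e2 w -> e1 = e2.
Proof.
have [_ triv _] := partP => P1 P2 w1 w2.
by apply: (triv e1 e2) => //; exists w.
Qed.

Lemma unions_of_atom A e w w' :
  unions_of PP A -> PP e -> e w -> e w' -> A w -> A w'.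
Proof.
move=> [F FP ->] Pe ew ew' [f Ff fw]; exists f => //.
by rewrite (partition_eq (FP _ Ff) Pe fw ew).
Qed.

Lemma unions_of0 : unions_of PP set0.
Proof. by exists set0; rewrite ?bigcup_set0//; exact: sub0set. Qed.

Lemma unions_ofU A B :
  unions_of PP A -> unions_of PP B -> unions_of PP (A `|` B).
Proof.
move=> [F FP ->] [G GP ->]; exists (F `|` G); last by rewrite bigcup_setU.
by move=> e [/FP|/GP].
Qed.

Lemma unions_of_inner E : unions_of PP (inner PP E).
Proof. by eexists; last reflexivity; move=> e []. Qed.

Lemma unions_of_outer E : unions_of PP (outer PP E).
Proof. by eexists; last reflexivity; move=> e []. Qed.

Lemma inner_atom E e w : PP e -> e w -> inner PP E w <-> e `<=` E.
Proof.
move=> Pe ew; split=> [[f [Pf fE] fw]|eE]; last by exists e.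
by rewrite (partition_eq Pe Pf ew fw).
Qed.

Lemma outer_atom E e w : PP e -> e w -> outer PP E w <-> e `&` E !=set0.
Proof.
move=> Pe ew; split=> [[f [Pf fE] fw]|eE]; last by exists e.
by rewrite (partition_eq Pe Pf ew fw).
Qed.

Lemma inner_sub E : inner PP E `<=` E.
Proof. by move=> w [e [_]]; apply. Qed.

Lemma sub_outer E : E `<=` outer PP E.
Proof.
move=> w Ew; have [e Pe ew] := partition_atom w.
by exists e => //; split=> //; exists w.
Qed.

Lemma inner_outer_disj E E' w :
  E `&` E' = set0 -> inner PP E w -> ~ outer PP E' w.
Proof.
move=> EE' [e [Pe eE] ew] /(outer_atom _ Pe ew)[v [/eE Ev E'v]].
by have : (E `&` E') v by []; rewrite EE'.
Qed.

(** This leaves the point free to move inside an atom: only the gain of the bets on [C|D] is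
    affected. *)
Lemma gain_cevents_of P x e w w' : AC x -> PP e -> e w -> e w' ->
  gain P 1 x w = gain P 1 x w'.
Proof.
move=> [A [B [B0 [uA uB ->]]]] Pe ew ew'; rewrite !gain_cevent !indicE.
have mem_atom (E : set Omega) : unions_of PP E -> (w \in E) = (w' \in E).
  move=> uE; apply/idP/idP; rewrite !inE; exact: unions_of_atom uE Pe _ _.
by rewrite !mem_atom.
Qed.

(** * Adjoining one conditional event to the domain *)

Section Adjoin.
Variables (mu nu : cgamble R Omega -> R) (C D : set Omega) (D0 : D !=set0).
Hypothesis neq0 : cevent R C D0 <> cevent R set0 D0.
Hypothesis neqT : cevent R C D0 <> cevent R D D0.
Hypothesis nuE : forall x, AC x -> nu x = mu x.

Local Notation CD := (cevent R C D0).
Local Notation CDi := (inner_cevent partP neqT).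
Local Notation CDo := (outer_cevent partP neq0).

Lemma inner_cevent_AC : AC CDi.
Proof.
do 3 eexists; split; last reflexivity; first exact: unions_of_inner.
by apply: unions_ofU; [exact: unions_of_inner|exact: unions_of_outer].
Qed.

Lemma outer_cevent_AC : AC CDo.
Proof.
do 3 eexists; split; last reflexivity; first exact: unions_of_outer.
by apply: unions_ofU; [exact: unions_of_outer|exact: unions_of_inner].
Qed.

Lemma extension_bounds S : AC `<=` S -> S CD ->
  avoids_swap_loss S nu -> unit_valued S nu ->
  mu CDi <= nu CD <= mu CDo.
Proof.
move=> ACS SCD swap unit; rewrite -!nuE; [|exact: outer_cevent_AC|
  exact: inner_cevent_AC].
(* Since these events are disjoint, a point in the outer approximation of one is not in the inner
   approximation of the other. *)
have CD0 : (C `&` D) `&` (~` C `&` D) = set0.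
  by apply/seteqP; split=> // w [[? _] [? _]].
apply/andP; split; apply: (goodman_nguyen_le swap unit) => //.
- exact/ACS/inner_cevent_AC.
- by move=> w [/inner_sub].
- move=> w /sub_outer oCD; split; last by right.
  by move=> /(inner_outer_disj CD0).
- exact/ACS/outer_cevent_AC.
- by move=> w /sub_outer oCD; split=> //; left.
- by move=> w [oCD [//|/inner_sub]].
Qed.

(* Bets on [0|D] have gain zero but enlarge the conditioning event: they are
   moved to [0|B], since only in the atoms of [B] is the matching point
   guaranteed to lie in [D]. *)
Lemma avoids_loss_replace S n (s : 'I_n.+1 -> R) x A B (B0 : B !=set0) :
    let t := \sum_(i < n.+1 | `[< x i = CD >]) s i in
    AC (cevent R A B0) -> AC (cevent R set0 B0) ->
    mu (cevent R set0 B0) = 0 -> nu (cevent R set0 D0) = 0 ->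
    S `<=` AC `|` [set CD] `|` [set cevent R set0 D0] ->
    (forall e w', PP e -> e w' -> exists w, [/\ e w, B w' -> D w &
       t * gain mu 1 (cevent R A B0) w' <= t * gain nu 1 CD w]) ->
    avoids_loss AC mu s -> (forall i, S (x i)) ->
  forall eps, 0 < eps -> exists2 w, exists i, cg_cond (x i) w &
    - eps < \sum_(i < n.+1) gain nu (s i) (x i) w.
Proof.
move=> t ACA AC0 mu0 nu0 SAC dom avoid Sx eps eps0.
pose y i := if `[< x i = CD >] then cevent R A B0
            else if `[< AC (x i) >] then x i else cevent R set0 B0.
have ACy i : AC (y i) by rewrite /y; case: asboolP => // _; case: asboolP.
have [w' [i yw'] gw'] := avoid y ACy _ eps0.
have [e Pe ew'] := partition_atom w'; have [w [ew BD le_t]] := dom _ _ Pe ew'.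
have x0E j : x j <> CD -> ~ AC (x j) -> x j = cevent R set0 D0.
  by move=> xCD xAC; case: (SAC _ (Sx j)) => [[]|].
exists w.
  exists i; move: yw'; rewrite /y; case: asboolP => [->|xCD]; first exact: BD.
  case: asboolP => [|xAC]; last by rewrite (x0E _ xCD xAC); exact: BD.
  move=> [A' [B' [B'0 [_ uB' ->]]]] /=.
  exact: unions_of_atom uB' Pe ew' ew.
(* All bets on [C|D] are evaluated at the same [w], so their corrections add up to [t] times one
   difference, which [dom] makes nonnegative; the individual signs of the stakes do not matter. *)
have gE j : gain nu (s j) (x j) w = gain mu (s j) (y j) w' +
    if `[< x j = CD >] then
      s j * (gain nu 1 CD w - gain mu 1 (cevent R A B0) w') else 0.
  rewrite /y !(gainZ _ (s j)); case: asboolP => [->|xCD].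
    by rewrite -mulrDr addrC subrK.
  rewrite addr0; congr (_ * _); case: asboolP => [xAC|xAC].
    by rewrite (gain_cevents_of _ xAC Pe ew ew') /gain nuE.
  by rewrite (x0E _ xCD xAC) !gain_cevent nu0 mu0 !indicE !in_set0 subrr !mulr0.
under eq_bigr do rewrite gE.
rewrite big_split /= -big_mkcond /= -mulr_suml -/t.
by apply: lt_le_trans gw' _; rewrite lerDl mulrBr subr_ge0.
Qed.

(** Pick the best point of the atom for a bet on [C|D]: one in [C] and [D] if there is any, with
    gains 1 minus the price; [w'] itself if the atom lies in [D] outside [C], with gains minus the
    price. Otherwise the atom has a point outside [D] and misses the conditioning event of [CDo], so
    both gains vanish. *)
Lemma gain_outer_cevent e w' : nu CD <= mu CDo -> PP e -> e w' ->
  exists w, [/\ e w, cg_cond CDo w' -> D w & gain mu 1 CDo w' <= gain nu 1 CD w].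
Proof.
move=> le_o Pe ew'.
have oE := outer_atom (C `&` D) Pe ew'.
have iE := inner_atom (~` C `&` D) Pe ew'.
rewrite /CDo.
have [/[dup] eCD [w [ew [Cw Dw]]]|neCD] := pselect (e `&` (C `&` D) !=set0).
  exists w; split=> //; rewrite !gain_cevent !indicE.
  by rewrite !mem_set//; [rewrite /=; lra|apply/oE|left; apply/oE].
have [eCD|neCD'] := pselect (e `<=` ~` C `&` D).
  have [Cw' Dw'] := eCD _ ew'.
  exists w'; split=> //; rewrite !gain_cevent !indicE.
  rewrite (mem_set Dw') (memNset Cw') (@memNset _ (outer _ _)); last first.
    by move=> /oE.
  by rewrite mem_set; [rewrite /=; lra|right; apply/iE].
have [w ew Dw] : exists2 w, e w & ~ D w.
  apply: contrapT => eD; apply: neCD' => w ew; split.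
    move=> Cw; apply: neCD; exists w; split=> //; split=> //.
    by apply: contrapT => Dw; apply: eD; exists w.
  by apply: contrapT => Dw; apply: eD; exists w.
have nB : ~ (outer PP (C `&` D) `|` inner PP (~` C `&` D)) w'.
  by move=> [/oE|/iE].
exists w; split=> //; rewrite !gain_cevent !indicE.
by rewrite (memNset nB) (memNset Dw) !mul0r.
Qed.

(** Dually, pick the worst point for a bet on [C|D]: one in [D] outside [C] if possible, else [w']
    if the atom lies in [C] and [D], else a point outside [D], where both bets are called off. *)
Lemma gain_inner_cevent e w' : mu CDi <= nu CD -> PP e -> e w' ->
  exists w, [/\ e w, cg_cond CDi w' -> D w & gain nu 1 CD w <= gain mu 1 CDi w'].
Proof.
move=> le_i Pe ew'.
have oE := outer_atom (~` C `&` D) Pe ew'.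
have iE := inner_atom (C `&` D) Pe ew'.
rewrite /CDi.
have [/[dup] eCD [w [ew [Cw Dw]]]|neCD] := pselect (e `&` (~` C `&` D) !=set0).
  exists w; split=> //; rewrite !gain_cevent !indicE.
  rewrite (memNset Cw) (mem_set Dw) (@memNset _ (inner _ _)); last first.
    by move=> /iE /(_ _ ew)[].
  by rewrite mem_set; [rewrite /=; lra|right; apply/oE].
have [eCD|neCD'] := pselect (e `<=` C `&` D).
  have [Cw' Dw'] := eCD _ ew'.
  exists w'; split=> //; rewrite !gain_cevent !indicE.
  by rewrite !mem_set//; [rewrite /=; lra|apply/iE|left; apply/iE].
have [w ew Dw] : exists2 w, e w & ~ D w.
  apply: contrapT => eD; apply: neCD' => w ew.
  have Dw : D w by apply: contrapT => Dw; apply: eD; exists w.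
  by split=> //; apply: contrapT => Cw; apply: neCD; exists w.
have nB : ~ (inner PP (C `&` D) `|` outer PP (~` C `&` D)) w'.
  by move=> [/iE|/oE].
exists w; split=> //; rewrite !gain_cevent !indicE.
by rewrite (memNset nB) (memNset Dw) !mul0r.
Qed.

Lemma avoids_loss_extension S n (s : 'I_n.+1 -> R) :
    S `<=` AC `|` [set CD] `|` [set cevent R set0 D0] ->
    zero_normed AC mu -> nu (cevent R set0 D0) = 0 ->
    mu CDi <= nu CD <= mu CDo ->
  avoids_loss AC mu s -> avoids_loss S nu s.
Proof.
move=> SAC zero nu0 /andP[le_i le_o] avoid x Sx eps eps0.
have AC0 A B (B0 : B !=set0) : unions_of PP B -> AC (cevent R set0 B0).
  by move=> uB; exists set0, B, B0; split=> //; exact: unions_of0.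
(* The sign of [t] depends on which gambles equal [C|D], so the target of the move is chosen only
   once [x] is given. *)
pose t := \sum_(i < n.+1 | `[< x i = CD >]) s i.
have [t0|t0] := leP 0 t.
- have uB := unions_ofU (unions_of_outer (C `&` D))
                        (unions_of_inner (~` C `&` D)).
  apply: (avoids_loss_replace outer_cevent_AC (AC0 set0 _ _ uB) _ nu0 SAC _
    avoid Sx eps0); first exact: zero (AC0 set0 _ _ uB).
  move=> e w' Pe ew'; have [w [ew BD le_g]] := gain_outer_cevent le_o Pe ew'.
  by exists w; split=> //; rewrite ler_wpM2l.
- have uB := unions_ofU (unions_of_inner (C `&` D))
                        (unions_of_outer (~` C `&` D)).
  apply: (avoids_loss_replace inner_cevent_AC (AC0 set0 _ _ uB) _ nu0 SAC _
    avoid Sx eps0); first exact: zero (AC0 set0 _ _ uB).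
  move=> e w' Pe ew'; have [w [ew BD le_g]] := gain_inner_cevent le_i Pe ew'.
  by exists w; split=> //; rewrite ler_wnM2l// ltW.
Qed.

End Adjoin.
End Extension.

(** * Elementary bets supplied by each notion *)

Section Notions.
Variables (R : realType) (Omega : Type).
Implicit Types (S : set (cgamble R Omega)) (P : cgamble R Omega -> R).

Lemma stakesN n s0 (s : 'I_n -> R) :
  (fun i => - stakes s0 s i) = stakes (- s0) (fun i => - s i).
Proof. by apply/funext => i; rewrite /stakes; case: unlift. Qed.

(** The negated stakes of an upper notion amount to exchanging the roles of [x] and [y]. *)
Lemma avoids_loss_swap S P :
  avoids_loss S P (stakes 1 (fun _ : 'I_1 => 1)) \/
  avoids_loss S P (stakes (- 1) (fun _ : 'I_1 => - 1)) ->
  avoids_swap_loss S P.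
Proof.
move=> [] avoid x y Sx Sy eps eps0.
  by have [w xyw] := avoids_loss_pair avoid Sx Sy eps0; exists w => //; lra.
have [w yxw] := avoids_loss_pair avoid Sy Sx eps0.
by exists w; [case: yxw; [right|left] | lra].
Qed.

Lemma W_coherent_lower_swap S P : W_coherent_lower S P -> avoids_swap_loss S P.
Proof.
by move=> /W_coherent_lowerP coh; apply: avoids_loss_swap; left; exact: coh.
Qed.

Lemma W_coherent_upper_swap S P : W_coherent_upper S P -> avoids_swap_loss S P.
Proof.
move=> /W_coherent_upperP coh; apply: avoids_loss_swap; right.
by rewrite -stakesN; exact: coh.
Qed.

(** Betting on [x] against itself leaves the net stake [s1 - s0]; the stakes 0 and 1, in either
    order, then give an isolated bet of each sign. *)
Lemma avoids_loss_single S P s0 s1 x eps :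
  avoids_loss S P (stakes s0 (fun _ : 'I_1 => s1)) -> S x -> 0 < eps ->
  exists2 w, cg_cond x w & - eps < (s1 - s0) * gain P 1 x w.
Proof.
move=> avoid Sx eps0; have [w xw] := avoids_loss_pair avoid Sx Sx eps0.
by rewrite -mulrBl; exists w => //; case: xw.
Qed.

Lemma W_coherent_lower_single S P :
  W_coherent_lower S P -> avoids_single_loss S P.
Proof.
move=> /W_coherent_lowerP coh x Sx eps eps0; split.
- have coh01 := coh 1%N 0 (fun=> 1) (lexx _) (fun=> ler01).
  have [w xw] := avoids_loss_single coh01 Sx eps0.
  by rewrite subr0 mul1r; exists w.
- have coh10 := coh 1%N 1 (fun=> 0) ler01 (fun=> lexx _).
  have [w xw] := avoids_loss_single coh10 Sx eps0.
  by rewrite sub0r mulN1r; exists w.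
Qed.

Lemma W_coherent_upper_single S P :
  W_coherent_upper S P -> avoids_single_loss S P.
Proof.
move=> /W_coherent_upperP coh x Sx eps eps0; split.
- have := coh 1%N 1 (fun=> 0) ler01 (fun=> lexx _); rewrite stakesN => coh10.
  have [w xw] := avoids_loss_single coh10 Sx eps0.
  by rewrite opprK oppr0 add0r mul1r; exists w.
- have := coh 1%N 0 (fun=> 1) (lexx _) (fun=> ler01); rewrite stakesN => coh01.
  have [w xw] := avoids_loss_single coh01 Sx eps0.
  by rewrite oppr0 subr0 mulN1r; exists w.
Qed.

Lemma C_convex_lower_swap S P : C_convex_lower S P -> avoids_swap_loss S P.
Proof.
move=> [/convex_lowerP cvx _]; apply: avoids_loss_swap; left.
by apply: cvx => //; rewrite big_ord1.
Qed.

Lemma C_convex_upper_swap S P : C_convex_upper S P -> avoids_swap_loss S P.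
Proof.
move=> /C_convex_upperP[cvx _]; apply: avoids_loss_swap; right.
by rewrite -stakesN; apply: cvx => //; rewrite big_ord1.
Qed.

Lemma dF_coherent_W_coherent_lower S P : dF_coherent S P -> W_coherent_lower S P.
Proof. by move=> /dF_coherentP coh; apply/W_coherent_lowerP => *; exact: coh. Qed.

Lemma avoids_loss_sub S S' P P' n (s : 'I_n -> R) :
  S `<=` S' -> (forall x, S x -> P x = P' x) ->
  avoids_loss S' P s -> avoids_loss S P' s.
Proof.
move=> SS' PP' avoid x Sx eps eps0.
have [w xw gw] := avoid x (fun i => SS' _ (Sx i)) _ eps0; exists w => //.
by under eq_bigr do rewrite /gain -PP'//.
Qed.

End Notions.

(** * Assembly of the five equivalences *)

Theorem proposition4 (R : realType) (Omega : Type)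
    (Omega_neq0 : [set: Omega] !=set0)
    (PP : set (set Omega)) (partP : partition PP id setT)
    (mu nu : cgamble R Omega -> R)
    (C D : set Omega) (D0 : D !=set0)
    (neq0 : cevent R C D0 <> cevent R set0 D0)
    (neqT : cevent R C D0 <> cevent R D D0)
    (nu_ext : {in cevents_of R PP, nu =1 mu}) :
  let AC := cevents_of R PP in
  let S := AC `|` [set cevent R C D0] in
  let S0 := S `|` [set cevent R set0 D0] in
  let in_range := nu (cevent R C D0) \in
    `[mu (inner_cevent partP neqT), mu (outer_cevent partP neq0)] in
  [/\ dF_coherent AC mu -> (dF_coherent S nu <-> in_range),
      W_coherent_lower AC mu -> (W_coherent_lower S nu <-> in_range),
      W_coherent_upper AC mu -> (W_coherent_upper S nu <-> in_range),
      C_convex_lower AC mu -> (C_convex_lower S0 (adjoin0 S nu) <-> in_range) &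
      C_convex_upper AC mu -> (C_convex_upper S0 (adjoin0 S nu) <-> in_range)].
Proof.
move=> AC S S0 in_range; rewrite {}/in_range in_itv /=.
have SCD : S (cevent R C D0) by right.
have ACS : AC `<=` S by move=> x; left.
have nuE x : AC x -> nu x = mu x by move=> ACx; apply: nu_ext; rewrite inE.
pose nu0 := adjoin0 S nu.
have nu0S x : S x -> nu0 x = nu x.
  by move=> Sx; rewrite /nu0 /adjoin0 patchE mem_set.
have nu0E x : AC x -> nu0 x = mu x by move=> ACx; rewrite nu0S ?nuE//; exact: ACS.
have nu00 : zero_normed AC mu -> nu0 (cevent R set0 D0) = 0.
  (* Either [0|D] is new and gets the default 0 of [adjoin0], or it lies in [AC], since it differs
     from [C|D], and [mu] vanishes there. *)
  move=> zero; have [S0D|nS0D] := pselect (S (cevent R set0 D0)); last first.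
    by rewrite /nu0 /adjoin0 patchE memNset.
  rewrite nu0S//; case: S0D => [AC0|/esym//]; rewrite nuE//; exact: zero.
(* Sufficiency is proved on the larger domain [S0], as convexity needs it, and then restricted to
   [S] for the other notions. *)
have ext n (s : 'I_n.+1 -> R) : zero_normed AC mu ->
    mu (inner_cevent partP neqT) <= nu (cevent R C D0)
      <= mu (outer_cevent partP neq0) ->
    avoids_loss AC mu s -> avoids_loss S0 nu0 s.
  move=> zero; rewrite -nu0S// => range.
  exact: (avoids_loss_extension nu0E (@subset_refl _ S0) zero (nu00 zero) range).
have extS n (s : 'I_n.+1 -> R) : zero_normed AC mu ->
    mu (inner_cevent partP neqT) <= nu (cevent R C D0)
      <= mu (outer_cevent partP neq0) ->
    avoids_loss AC mu s -> avoids_loss S nu s.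
  move=> zero range avoid.
  by apply: avoids_loss_sub (ext _ s zero range avoid) => // x; left.
(* Necessity has two forms, differing in why prices lie in [0, 1]: isolated bets here, centering in
   [bounds0]. *)
have bounds (coh : avoids_swap_loss S nu) (single : avoids_single_loss S nu) :=
  extension_bounds partP neq0 neqT nuE ACS SCD coh (unit_valued_single single).
have bounds0 : avoids_swap_loss S0 nu0 -> centered S0 nu0 ->
    mu (inner_cevent partP neqT) <= nu (cevent R C D0)
      <= mu (outer_cevent partP neq0).
  move=> swap cen; rewrite -nu0S//.
  have ACS0 : AC `<=` S0 by move=> x ACx; left; left.
  have S0CD : S0 (cevent R C D0) by left.
  exact: (extension_bounds partP neq0 neqT nu0E ACS0 S0CD swap
    (unit_valued_centered cen swap)).
have cen0 : centered AC mu -> centered S0 nu0.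
  move=> cen; have zero := zero_normed_centered cen.
  move=> x [[ACx|->]|->] /=.
  - by have [ACz muz] := cen _ ACx; split; [left; left | rewrite nu0E].
  - by rewrite -cevent_set0; split; [right | exact: nu00].
  - by rewrite -cevent_set0; split; [right | exact: nu00].
split.
- move=> coh; split=> [/dF_coherent_W_coherent_lower cohS|range].
    by apply: bounds; [exact: W_coherent_lower_swap|
      exact: W_coherent_lower_single].
  have /W_coherent_lower_single/zero_normed_single zero :=
    dF_coherent_W_coherent_lower coh.
  move/dF_coherentP : coh => coh.
  by apply/dF_coherentP => n s; apply: extS => //; exact: coh.
- move=> coh; split=> [cohS|range].
    by apply: bounds; [exact: W_coherent_lower_swap|
      exact: W_coherent_lower_single].
  have zero := zero_normed_single (W_coherent_lower_single coh).
  move/W_coherent_lowerP : coh => coh.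
  by apply/W_coherent_lowerP => n s0 s ? ?; apply: extS => //; exact: coh.
- move=> coh; split=> [cohS|range].
    by apply: bounds; [exact: W_coherent_upper_swap|
      exact: W_coherent_upper_single].
  have zero := zero_normed_single (W_coherent_upper_single coh).
  move/W_coherent_upperP : coh => coh.
  by apply/W_coherent_upperP => n s0 s ? ?; apply: extS => //; exact: coh.
- move=> [/convex_lowerP cvx cen].
  split=> [cohS|range].
    by apply: bounds0; [exact: C_convex_lower_swap|exact: cohS.2].
  split; last exact: cen0.
  apply/convex_lowerP => n s0 s ? ? ?.
  by apply: ext => //; [exact: zero_normed_centered|exact: cvx].
- move=> /C_convex_upperP[cvx cen]; split=> [cohS|range].
    apply: bounds0; first exact: C_convex_upper_swap.
    by move/C_convex_upperP : cohS => [].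
  apply/C_convex_upperP; split; last exact: cen0.
  move=> n s0 s ? ? ?.
  by apply: ext => //; [exact: zero_normed_centered|exact: cvx].
Qed.
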